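(* Let $\langle\mathbf A,\sim,\exists,\forall\rangle$ be an $MG_\sim$-algebra. The correspondence $\mathbf F_{mr}(\langle\mathbf A,\sim,\exists,\forall\rangle)\to\mathbf{Con}(\langle\mathbf A,\sim,\exists,\forall\rangle)$ defined by $F\mapsto\theta_F=\{(a,b)\in A^2:(a\to b)\wedge(b\to a)\in F\}$ is an order isomorphism whose inverse is given by $\theta\mapsto 1/\theta$.
   Context: A Gödel algebra is a Heyting algebra $\langle A,\vee,\wedge,\to,0,1\rangle$ satisfying $(x\to y)\vee(y\to x)\approx 1$; put $\neg x:=x\to 0$. A De Morgan algebra is a bounded distributive lattice with a unary operation $\sim$ satisfying $\sim\sim x\approx x$ and $\sim(x\wedge y)\approx \sim x\vee\sim y$. A $G_\sim$-algebra $\langle \mathbf A,\sim\rangle$ is a Gödel algebra $\mathbf A$ with a unary operation $\sim$ that makes its bounded lattice reduct a De Morgan algebra and satisfies $\neg x\le\sim x$; put $\Delta x:=\neg\sim x$. An $MG_\sim$-algebra is an algebra $\langle A,\vee,\wedge,\to,\sim,\exists,\forall,0,1\rangle$ such that $\langle \mathbf A,\sim\rangle$ is a $G_\sim$-algebra and: (M1) $\forall x\to x\approx 1$; (M2) $\forall(x\to\forall y)\approx\exists x\to\forall y$; (M3) $\forall(\forall x\to y)\approx\forall x\to\forall y$; (M4) $\forall(\exists x\vee y)\approx\exists x\vee\forall y$; (Q) $\forall x\approx\ \sim\exists\sim x$. A filter is a nonempty up-closed subset closed under $\wedge$. A filter $F$ of an $MG_\sim$-algebra is monadic regular if $x\in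 F$ implies $\Delta x\in F$ and $\forall x\in F$; $\mathbf F_{mr}$ denotes the lattice of monadic regular filters ordered by inclusion. $\mathbf{Con}$ denotes the congruence lattice, and $1/\theta$ is the $\theta$-class of $1$. *)

(* Defs.v *)
From HB Require Import structures.
From mathcomp Require Import all_boot all_order.
From mathcomp Require Import boolp classical_sets functions.

Set Implicit Arguments.
Unset Strict Implicit.
Unset Printing Implicit Defensive.

Import Order.TTheory.

Local Open Scope order_scope.

Reserved Notation "x ⇒ y" (at level 55, right associativity).
Reserved Notation "¬ x" (at level 35, right associativity).
Reserved Notation "∼ x" (at level 35, right associativity).

(* Ordered types carry a choice structure; classically every type has one, so
   no algebra is excluded. The trivial algebra (\bot = \top) is allowed. *)
HB.mixin Record TBLattice_isHeyting (d : Order.disp_t) T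
    of Order.TBLattice d T := {
  himp : T -> T -> T;
  himpP : forall x y z : T, (Order.meet z x <= y) = (z <= himp x y);
}.

#[short(type="heytingType")]
HB.structure Definition Heyting (d : Order.disp_t) :=
  { T of Order.TBLattice d T & TBLattice_isHeyting d T }.

Notation "x ⇒ y" := (himp x y) : order_scope.

Definition hneg {d : Order.disp_t} {T : heytingType d} (x : T) : T := x ⇒ \bot.

Notation "¬ x" := (hneg x) : order_scope.

HB.mixin Record Heyting_isGodel (d : Order.disp_t) T of Heyting d T := {
  prelinearity : forall x y : T, Order.join (himp x y) (himp y x) = \top;
}.

#[short(type="godelType")]
HB.structure Definition Godel (d : Order.disp_t) :=
  { T of Heyting d T & Heyting_isGodel d T }.

HB.mixin Record TBDistrLattice_isDeMorgan (d : Order.disp_t) T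
    of Order.TBDistrLattice d T := {
  dmneg : T -> T;
  dmnegK : forall x : T, dmneg (dmneg x) = x;
  dmnegI : forall x y : T,
    dmneg (Order.meet x y) = Order.join (dmneg x) (dmneg y);
}.

#[short(type="deMorganType")]
HB.structure Definition DeMorgan (d : Order.disp_t) :=
  { T of Order.TBDistrLattice d T & TBDistrLattice_isDeMorgan d T }.

Notation "∼ x" := (dmneg x) : order_scope.

HB.mixin Record Godel_DeMorgan_isGTilde (d : Order.disp_t) T
    of Godel d T & DeMorgan d T := {
  hneg_le_dmneg : forall x : T, ¬ x <= ∼ x;
}.

#[short(type="gTildeType")]
HB.structure Definition GTilde (d : Order.disp_t) :=
  { T of Godel d T & DeMorgan d T & Godel_DeMorgan_isGTilde d T }.

Definition Delta {d : Order.disp_t} {T : gTildeType d} (x : T) : T := ¬ ∼ x.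

HB.mixin Record GTilde_isMonadic (d : Order.disp_t) T of GTilde d T := {
  mex : T -> T;
  mall : T -> T;
  mall_imp : forall x : T, mall x ⇒ x = \top;
  mall_imp_mall : forall x y : T, mall (x ⇒ mall y) = mex x ⇒ mall y;
  mall_mall_imp : forall x y : T, mall (mall x ⇒ y) = mall x ⇒ mall y;
  mall_mex_join : forall x y : T,
    mall (Order.join (mex x) y) = Order.join (mex x) (mall y);
  mallE : forall x : T, mall x = ∼ mex (∼ x);
}.

#[short(type="mgTildeType")]
HB.structure Definition MGTilde (d : Order.disp_t) :=
  { T of GTilde d T & GTilde_isMonadic d T }.

Local Open Scope classical_set_scope.

Definition is_lattice_filter {d : Order.disp_t} {T : tbLatticeType d}
    (F : set T) : Prop :=
  [/\ F !=set0,
      forall x y : T, F x -> (x <= y)%O -> F y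
    & forall x y : T, F x -> F y -> F (Order.meet x y)].

Definition monadic_regular {d : Order.disp_t} {T : mgTildeType d}
    (F : set T) : Prop :=
  forall x : T, F x -> F (Delta x) /\ F (mall x).

Definition mr_filters {d : Order.disp_t} (T : mgTildeType d) : set (set T) :=
  [set F | is_lattice_filter F /\ monadic_regular F].

Arguments mr_filters {d} T.

Definition compat1 {T : Type} (theta : set (T * T)) (f : T -> T) : Prop :=
  forall a b : T, theta (a, b) -> theta (f a, f b).

Definition compat2 {T : Type} (theta : set (T * T)) (f : T -> T -> T) : Prop :=
  forall a b a' b' : T,
    theta (a, b) -> theta (a', b') -> theta (f a a', f b b').

Definition is_equivalence {T : Type} (theta : set (T * T)) : Prop :=
  [/\ forall a : T, theta (a, a),
      forall a b : T, theta (a, b) -> theta (b, a)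
    & forall a b c : T, theta (a, b) -> theta (b, c) -> theta (a, c)].

(* The constants 0 and 1 impose no compatibility condition. *)
Definition congruences {d : Order.disp_t} (T : mgTildeType d) :
    set (set (T * T)) :=
  [set theta | is_equivalence theta /\
    [/\ compat2 theta Order.join, compat2 theta Order.meet
      & compat2 theta himp] /\
    [/\ compat1 theta dmneg, compat1 theta mex & compat1 theta mall]].

Arguments congruences {d} T.

Definition theta_of {d : Order.disp_t} {T : mgTildeType d} (F : set T) :
    set (T * T) :=
  [set ab | F (Order.meet (ab.1 ⇒ ab.2)%O (ab.2 ⇒ ab.1)%O)].

Definition one_class {d : Order.disp_t} {T : mgTildeType d}
    (theta : set (T * T)) : set T :=
  [set a | theta (\top%O, a)].

(* P and Q are families of subsets, both ordered by inclusion. *)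
Definition order_iso {S T : Type} (P : set (set S)) (Q : set (set T))
    (f : set S -> set T) : Prop :=
  set_bij P Q f /\
  forall F G : set S, P F -> P G -> (F `<=` G <-> f F `<=` f G).

Definition inverse_on {S T : Type} (P : set S) (Q : set T)
    (f : S -> T) (g : T -> S) : Prop :=
  [/\ set_fun Q P g,
      forall x : S, P x -> g (f x) = x
    & forall y : T, Q y -> f (g y) = y].

(* Main.v *)
Require Import Defs.
From mathcomp Require Import all_boot all_order.
From mathcomp Require Import boolp classical_sets functions.

(** Modus ponens makes [theta_of F] a Heyting congruence for any filter [F].
    Compatibility with the remaining operations rests on two inequalities,
    [Delta (a ⇒ b) <= ∼ b ⇒ ∼ a] and [mall (a ⇒ b) <= mall a ⇒ mall b], together
    with [mex a = ∼ mall (∼ a)].  Conversely [Delta] and [mall] fix [\top], so the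
    class of [\top] is monadic regular, and [a /\ (a ⇒ b) = a /\ b] recovers a
    congruence from that class. *)

Set Implicit Arguments.
Unset Strict Implicit.
Unset Printing Implicit Defensive.

Import Order.TTheory.

Local Open Scope classical_set_scope.
Local Open Scope order_scope.

Section Heyting.
Context {d : Order.disp_t} {T : heytingType d}.
Implicit Types x y z : T.

Lemma meet_himp_le x y : Order.meet (x ⇒ y) x <= y.
Proof. by rewrite himpP. Qed.

Lemma himp_eqT x y : (x ⇒ y == \top) = (x <= y).
Proof. by rewrite -le1x -himpP meet1x. Qed.

Lemma himpxx x : x ⇒ x = \top.
Proof. by apply/eqP; rewrite himp_eqT. Qed.

Lemma himpTx x : \top ⇒ x = x.
Proof.
apply/le_anti/andP; split; last by rewrite -himpP meetx1.
by rewrite -[leLHS]meetx1 meet_himp_le.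
Qed.

Lemma himpxT x : x ⇒ \top = \top.
Proof. by apply/eqP; rewrite himp_eqT lex1. Qed.

Lemma meet_himp x y : Order.meet x (x ⇒ y) = Order.meet x y.
Proof.
apply/le_anti/andP; split; rewrite lexI leIl /=.
  by rewrite meetC meet_himp_le.
by rewrite -himpP (le_trans (leIl _ _)) // leIr.
Qed.

Lemma himp_trans_le x y z : Order.meet (x ⇒ y) (y ⇒ z) <= x ⇒ z.
Proof.
rewrite -himpP meetAC; apply: le_trans (meet_himp_le y z).
by rewrite [leRHS]meetC leI2 // meet_himp_le.
Qed.

Lemma himp_meet_le x y x' y' :
  Order.meet (x ⇒ y) (x' ⇒ y') <= Order.meet x x' ⇒ Order.meet y y'.
Proof. by rewrite -himpP meetACA leI2 ?meet_himp_le. Qed.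

(* Adjunction avoids distributivity, which a [heytingType] does not carry. *)
Lemma himp_join_le x y x' y' :
  Order.meet (x ⇒ y) (x' ⇒ y') <= Order.join x x' ⇒ Order.join y y'.
Proof.
set u := Order.meet _ _.
suff : Order.join x x' <= u ⇒ Order.join y y' by rewrite -!himpP meetC.
rewrite leUx -!himpP; apply/andP; split.
  apply: le_trans (leUl y y'); apply: le_trans (meet_himp_le x y).
  by rewrite meetC leI2 // leIl.
apply: le_trans (leUr y' y); apply: le_trans (meet_himp_le x' y').
by rewrite meetC leI2 // leIr.
Qed.

(** [⇒] is antitone on the left, hence the reversed [y ⇒ x]: the bound composes [y ⇒ x], [x ⇒ x']
    and [x' ⇒ y']. *)
Lemma himp_himp_le x y x' y' :
  Order.meet (y ⇒ x) (x' ⇒ y') <= (x ⇒ x') ⇒ (y ⇒ y').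
Proof.
rewrite -himpP meetAC; apply: le_trans (himp_trans_le y x' y').
by rewrite leI2 // himp_trans_le.
Qed.

End Heyting.

Section DeMorgan.
Context {d : Order.disp_t} {T : deMorganType d}.
Implicit Types x y : T.

Lemma le_dmneg x y : x <= y -> ∼ y <= ∼ x.
Proof. by move=> /meet_l <-; rewrite dmnegI leUr. Qed.

Lemma dmnegT : ∼ (\top : T) = \bot.
Proof. by apply/eqP; rewrite -lex0 -[leRHS]dmnegK le_dmneg ?lex1. Qed.

End DeMorgan.

Section Monadic.
Context {d : Order.disp_t} {T : mgTildeType d}.
Implicit Types x y : T.

Lemma DeltaT : Delta (\top : T) = \top.
Proof. by rewrite /Delta dmnegT /hneg himpxx. Qed.

(** Applying [∼] to modus ponens gives [∼ y <= ∼ (x ⇒ y) \/ ∼ x]. Since [Delta (x ⇒ y)] is the [¬]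
    of the first disjunct, meeting with it and distributing leaves only [∼ x]. *)
Lemma Delta_himp_le x y : Delta (x ⇒ y) <= ∼ y ⇒ ∼ x.
Proof.
rewrite -himpP.
have le_y : ∼ y <= Order.join (∼ (x ⇒ y)) (∼ x).
  by rewrite -dmnegI le_dmneg ?meet_himp_le.
apply: (le_trans (leI2 (lexx _) le_y)).
rewrite meetUr leUx leIr andbT.
by apply: le_trans (le0x _); apply: meet_himp_le.
Qed.

Lemma mall_le x : mall x <= x.
Proof. by rewrite -himp_eqT mall_imp. Qed.

Lemma mallT : mall (\top : T) = \top.
Proof. by rewrite -(mall_imp (\top : T)) mall_mall_imp himpxx himpxT. Qed.

(** By [mall_mall_imp], [mall x ⇒ mall y] is [mall] of [mall x ⇒ y], which is [\top] here. *)
Lemma le_mall_mall x y : mall x <= y -> mall x <= mall y.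
Proof.
by rewrite -!himp_eqT -mall_mall_imp => /eqP ->; rewrite mallT.
Qed.

Lemma mall_himp_le x y : mall (x ⇒ y) <= mall x ⇒ mall y.
Proof.
rewrite -mall_mall_imp; apply: le_mall_mall; rewrite -himpP.
apply: le_trans (meet_himp_le x y); by rewrite leI2 ?mall_le.
Qed.

Lemma mexE x : mex x = ∼ mall (∼ x).
Proof. by rewrite mallE !dmnegK. Qed.

End Monadic.

Section FilterCongruence.
Context {d : Order.disp_t} {T : mgTildeType d}.
Implicit Types (F : set T) (theta : set (T * T)) (a b : T).

Lemma theta_ofP F a b : is_lattice_filter F ->
  theta_of F (a, b) <-> F (a ⇒ b) /\ F (b ⇒ a).
Proof.
move=> [_ Fup FI]; split=> [Fab|[Fab Fba]]; last exact: FI.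
by split; apply: Fup Fab _; rewrite ?leIl ?leIr.
Qed.

Lemma theta_of_congruence F : mr_filters T F -> congruences T (theta_of F).
Proof.
move=> [filtF mrF]; have [[x0 Fx0] Fup FI] := filtF.
have FT : F \top by apply: Fup Fx0 (lex1 _).
have tP a b := theta_ofP a b filtF.
have c1 (f : T -> T) : (forall a b, F (a ⇒ b) -> F (f a ⇒ f b)) ->
    compat1 (theta_of F) f.
  by move=> fF a b /tP[Fab Fba]; apply/tP; split; apply: fF.
(* [∼] is antitone, so the two implications trade places and [c1] does not apply. *)
have cneg : compat1 (theta_of F) dmneg.
  move=> a b /tP[/mrF[Fab _] /mrF[Fba _]]; apply/tP.
  by split; [apply: Fup Fba _|apply: Fup Fab _]; exact: Delta_himp_le.
have call : compat1 (theta_of F) mall.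
  apply: c1 => a b /mrF[_ Fab].
  by apply: Fup Fab _; exact: mall_himp_le.
split; [|split]; split.
- by move=> a; apply/tP; rewrite himpxx.
- by move=> a b /tP[Fab Fba]; apply/tP.
- move=> a b c /tP[Fab Fba] /tP[Fbc Fcb]; apply/tP.
  split; first by apply: Fup (FI _ _ Fab Fbc) _; exact: himp_trans_le.
  by apply: Fup (FI _ _ Fcb Fba) _; exact: himp_trans_le.
- move=> a b a' b' /tP[Fab Fba] /tP[Fab' Fba']; apply/tP.
  split; first by apply: Fup (FI _ _ Fab Fab') _; exact: himp_join_le.
  by apply: Fup (FI _ _ Fba Fba') _; exact: himp_join_le.
- move=> a b a' b' /tP[Fab Fba] /tP[Fab' Fba']; apply/tP.
  split; first by apply: Fup (FI _ _ Fab Fab') _; exact: himp_meet_le.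
  by apply: Fup (FI _ _ Fba Fba') _; exact: himp_meet_le.
- move=> a b a' b' /tP[Fab Fba] /tP[Fab' Fba']; apply/tP.
  split; first by apply: Fup (FI _ _ Fba Fab') _; exact: himp_himp_le.
  by apply: Fup (FI _ _ Fab Fba') _; exact: himp_himp_le.
- exact: cneg.
- by move=> a b tab; rewrite !mexE; apply/cneg/call/cneg.
- exact: call.
Qed.

Lemma one_class_mr_filter theta :
  congruences T theta -> mr_filters T (one_class theta).
Proof.
move=> [[refl _ _] [[cU cI cH] [cN _ cA]]]; rewrite /one_class.
split; first split.
- by exists \top; exact: refl.
(* Joining [\top] and [x] with [y] relates [\top \/ y = \top] to [x \/ y = y]. *)
- move=> x y /= tx /join_r <-; rewrite -[X in theta (X, _)](join1x y).
  by apply: cU (refl y).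
- by move=> x y /= tx ty; rewrite -[X in theta (X, _)]meetxx; apply: cI.
- move=> x /= tx; split; last by rewrite -[X in theta (X, _)]mallT; apply: cA.
  (* [Delta x] unfolds to [∼ x ⇒ \bot], so it inherits compatibility from [∼] and [⇒]. *)
  rewrite -[X in theta (X, _)]DeltaT; apply: cH (refl _); exact: cN.
Qed.

(** [(\top ⇒ x) /\ (x ⇒ \top)] simplifies to [x]. This left inverse yields both injectivity and
    reflection of inclusion. *)
Lemma one_class_theta_of F : one_class (theta_of F) = F.
Proof.
by apply/funext => x; rewrite /one_class /theta_of /= himpTx himpxT meetx1.
Qed.

Lemma theta_of_one_class theta :
  congruences T theta -> theta_of (one_class theta) = theta.
Proof.
move=> ct; have [filt1 _] := one_class_mr_filter ct.
have [[refl sym trans] [[_ cI cH] _]] := ct.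
(* Both [a] and [b] will be linked through [a /\ b]: meeting [\top] and [a ⇒ b] with [a] relates [a]
   to [a /\ (a ⇒ b) = a /\ b]. *)
have to_meet a b : theta (\top, a ⇒ b) -> theta (a, Order.meet a b).
  move=> tab; rewrite -meet_himp -[X in theta (X, _)]meetx1.
  exact: cI (refl a) tab.
apply/seteqP; split=> -[a b].
  move=> /(theta_ofP _ _ filt1)[/to_meet tab /to_meet tba].
  by apply: trans tab _; rewrite meetC; exact: sym.
(* Here [\top] is viewed as [a ⇒ a], then as [b ⇒ b], and one side of the implication is replaced
   along [theta]. *)
move=> tab; apply/(theta_ofP _ _ filt1); rewrite /one_class /=; split.
  by rewrite -(himpxx a); apply: cH.
by rewrite -(himpxx b); apply: cH => //; exact: sym.
Qed.

End FilterCongruence.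

Theorem proposition2p2 (d : Order.disp_t) (T : mgTildeType d) :
  order_iso (mr_filters T) (congruences T) theta_of /\
  inverse_on (mr_filters T) (congruences T) theta_of one_class.
Proof.
split; last first.
  split; [exact: one_class_mr_filter| |exact: theta_of_one_class].
  by move=> F _; exact: one_class_theta_of.
split; first split.
- exact: theta_of_congruence.
- move=> F G _ _ eqFG.
  by rewrite -(one_class_theta_of F) eqFG one_class_theta_of.
- move=> theta ct; exists (one_class theta); first exact: one_class_mr_filter.
  exact: theta_of_one_class.
- move=> F G _ _; split=> [FG ab|FG]; first exact: FG.
  (* Membership of [x] is read off at the pair [(\top, x)]. *)
  rewrite -(one_class_theta_of F) -(one_class_theta_of G) => x; exact: FG.
Qed.
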